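(* The functor $\mathcal S\colon \mathsf{Bms}\to \mathsf{uS\ell g}^{\mathrm{op}}$ is an equivalence of categories between the category $\mathsf{Bms}$ of boolean multispaces and the opposite of the category $\mathsf{uS\ell g}$ of unital Specker $\ell$-groups.
   Context: An $\ell$-group is a lattice-ordered abelian group. A (strong order) unit of an $\ell$-group $G$ is an element $u\ge 0$ such that for every $g\in G$ there is $n\in\mathbb Z_{>0}$ with $|g|\le nu$; the pair $(G,u)$ is a unital $\ell$-group. A unital $\ell$-homomorphism $(G,u_G)\to(H,u_H)$ is an $\ell$-homomorphism $\psi$ with $\psi(u_G)=u_H$. A singular element of $G$ is $s\ge 0$ such that $a\wedge(s-a)=0$ for all $0\le a\le s$. A Specker $\ell$-group is an $\ell$-group generated, as a group, by its singular elements; a unital Specker $\ell$-group is a pair $(S,u)$ with $S$ a Specker $\ell$-group and $u$ a unit of $S$. $\mathsf{uS\ell g}$ is the category of unital Specker $\ell$-groups and unital $\ell$-homomorphisms. A boolean space is a totally disconnected compact Hausdorff space. A boolean multispace is a pair $(X,u)$ with $X$ a boolean space and $u\colon X\to\mathbb Z_{>0}=\{1,2,\dots\}$ continuous ($\mathbb Z_{>0}$ discrete). A morphism $(X,u_X)\to(Y,u_Y)$ in the category $\mathsf{Bms}$ is a continuous map $\gamma\colon X\to Y$ such that $u_Y(\gamma(x))$ divides $u_X(x)$ for every $x\in X$; composition is composition of maps. For a boolean space $X$, $C_X$ denotes the $\ell$-group (pointwise operations) of all continuous functions $X\to\mathbb Z$ ($\mathbb Z$ discrete). The functor $\mathcal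 S$ sends $(X,u)$ to $(C_X,u)$, and sends a $\mathsf{Bms}$-morphism $\gamma\colon(W,u_W)\to(V,u_V)$ to the unital $\ell$-homomorphism $\mathcal S_\gamma\colon (C_V,u_V)\to(C_W,u_W)$ given by $\mathcal S_\gamma(f)(w)=f(\gamma(w))\cdot \frac{u_W(w)}{u_V(\gamma(w))}$. *)

(* Defs.v *)
From HB Require Import structures.
From mathcomp Require Import all_boot all_order all_algebra.
From mathcomp Require Import all_classical.
From mathcomp Require Import topology.
From mathcomp Require Import zify.

Set Implicit Arguments.
Unset Strict Implicit.
Unset Printing Implicit Defensive.

Import Order.TTheory GRing.Theory Num.Theory.

Local Open Scope classical_set_scope.
Local Open Scope ring_scope.

Record category := Category {
  obj :> Type;
  hom : obj -> obj -> Type;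
  idm : forall a, hom a a;
  (* diagrammatic order: [comp f g] is g after f *)
  comp : forall a b c, hom a b -> hom b c -> hom a c;
  comp1m : forall a b (f : hom a b), comp (idm a) f = f;
  compm1 : forall a b (f : hom a b), comp f (idm b) = f;
  compA : forall a b c d (f : hom a b) (g : hom b c) (h : hom c d),
    comp f (comp g h) = comp (comp f g) h
}.
Arguments comp {c a b c0} f g : rename.
Arguments idm {c} a : rename.

Definition opposite (C : category) : category :=
  @Category C (fun a b => hom b a) (fun a => idm a)
    (fun a b c f g => comp g f)
    (fun a b f => compm1 f) (fun a b f => comp1m f)
    (fun a b c d f g h => esym (compA h g f)).

Record functor (C D : category) := Functor {
  fobj :> C -> D;
  fmap : forall a b, hom a b -> hom (fobj a) (fobj b);
  fmap1 : forall a, fmap (idm a) = idm (fobj a);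
  fmapM : forall a b c (f : hom a b) (g : hom b c),
    fmap (comp f g) = comp (fmap f) (fmap g)
}.
Arguments fmap {C D} f {a b} : rename.

Definition id_functor (C : category) : functor C C :=
  @Functor C C id (fun a b f => f) (fun a => erefl) (fun a b c f g => erefl).

Section CompFunctor.
Context (C D E : category) (F : functor C D) (G : functor D E).

Definition comp_fmap a b (f : hom a b) : hom (G (F a)) (G (F b)) :=
  fmap G (fmap F f).

Lemma comp_fmap1 a : comp_fmap (idm a) = idm (G (F a)).
Proof. by rewrite /comp_fmap !fmap1. Qed.

Lemma comp_fmapM a b c (f : hom a b) (g : hom b c) :
  comp_fmap (comp f g) = comp (comp_fmap f) (comp_fmap g).
Proof. by rewrite /comp_fmap !fmapM. Qed.

(* [comp_functor F G] is G after F *)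
Definition comp_functor : functor C E := Functor comp_fmap1 comp_fmapM.

End CompFunctor.

Definition is_iso (C : category) (a b : C) (f : hom a b) : Prop :=
  exists g : hom b a, comp f g = idm a /\ comp g f = idm b.

Definition naturally_isomorphic (C D : category) (F G : functor C D) : Prop :=
  exists eta : forall a, hom (F a) (G a),
    (forall a, is_iso (eta a)) /\
    (forall a b (f : hom a b), comp (fmap F f) (eta b) = comp (eta a) (fmap G f)).

Definition is_equivalence (C D : category) (F : functor C D) : Prop :=
  exists G : functor D C,
    naturally_isomorphic (id_functor C) (comp_functor F G) /\
    naturally_isomorphic (comp_functor G F) (id_functor D).

(* [Order.Lattice] and [GRing.Zmodule] are already joined by [Num.RealDomain],
   so HB rejects a later structure that inherits from both. The lattice
   operations are therefore fields here, with the same axioms as the library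
   factory [Order.POrder_MeetJoin_isLattice]. *)
HB.mixin Record isLGroup G & Num.POrderedZmodule G := {
  lmeet : G -> G -> G;
  ljoin : G -> G -> G;
  lmeetP : forall x y z : G, (x <= lmeet y z) = (x <= y) && (x <= z);
  ljoinP : forall x y z : G, (ljoin x y <= z) = (x <= z) && (y <= z);
  lgroup_leD2l : forall z x y : G, x <= y -> z + x <= z + y
}.

#[short(type="lgroupType")]
HB.structure Definition LGroup := {G of Num.POrderedZmodule G & isLGroup G}.

Section LGroupDefs.
Context (G : lgroupType).

Definition lgroup_abs (g : G) : G := ljoin g (- g).

Definition is_unit (u : G) : Prop :=
  0 <= u /\ forall g : G, exists2 n, (0 < n)%N & lgroup_abs g <= u *+ n.

Definition singular : set G :=
  [set s | 0 <= s /\ forall a, 0 <= a -> a <= s -> lmeet a (s - a) = 0].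

Definition specker : Prop :=
  smallest [set H : set G | zmod_closed (mem H)] singular = [set: G].

End LGroupDefs.

Record unital_specker := UnitalSpecker {
  us_group :> lgroupType;
  us_unit : us_group;
  us_specker : specker us_group;
  us_unitP : is_unit us_unit
}.
Arguments us_unit : clear implicits.

Record is_unital_lhom (G H : unital_specker) (f : G -> H) : Prop := IsUnitalLHom {
  lhomD : {morph f : x y / x + y};
  lhom_meet : {morph f : x y / lmeet x y};
  lhom_join : {morph f : x y / ljoin x y};
  lhom_unit : f (us_unit G) = us_unit H
}.

Record unital_lhom (G H : unital_specker) := UnitalLHom {
  lhom_fun :> G -> H;
  lhomP : is_unital_lhom lhom_fun
}.

Lemma unital_lhom_eq G H (f g : unital_lhom G H) : f =1 g -> f = g.
Proof.
case: f g => [f fP] [g gP] /= /funext fg; rewrite -fg in gP *.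
by congr UnitalLHom; exact: Prop_irrelevance.
Qed.

Lemma is_unital_lhom_id (G : unital_specker) : is_unital_lhom (@idfun G).
Proof. by []. Qed.

Lemma is_unital_lhom_comp (G H K : unital_specker)
    (f : unital_lhom G H) (g : unital_lhom H K) : is_unital_lhom (g \o f).
Proof.
case: f g => [f [fD fI fU f1]] [g [gD gI gU g1]] /=.
by split=> [x y|x y|x y|] /=; rewrite ?(fD, fI, fU, f1) ?(gD, gI, gU, g1).
Qed.

Definition uSlg : category.
Proof.
refine (@Category unital_specker unital_lhom
  (fun G => UnitalLHom (is_unital_lhom_id G))
  (fun G H K f g => UnitalLHom (is_unital_lhom_comp f g)) _ _ _).
- by move=> G H f; exact: unital_lhom_eq.
- by move=> G H f; exact: unital_lhom_eq.
- by move=> G H K L f g h; exact: unital_lhom_eq.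
Defined.

Definition ctsZ (X : topologicalType) : Type :=
  continuousType X (discrete_topology int).

Definition ctsZ_fun (X : topologicalType) (f : ctsZ X) : X -> int := f.
Coercion ctsZ_fun : ctsZ >-> Funclass.

HB.instance Definition _ (X : topologicalType) :=
  Choice.copy (ctsZ X) (continuousType X (discrete_topology int)).

Section CtsZ.
Context (X : topologicalType).
Implicit Types f g h : ctsZ X.

Lemma ctsZP f g : f =1 g -> f = g.
Proof. by move=> fg; apply/(continuousEP f g). Qed.

Lemma locally_constant_cts (f : X -> int) :
  (forall x, \forall y \near x, f y = f x) ->
  continuous (f : X -> discrete_topology int).
Proof. by move=> fx x; apply/discrete_cvg; exact: fx. Qed.

Lemma ctsZ_near f (x : X) : \forall y \near x, f y = f x.
Proof.
have : continuous (f : X -> discrete_topology int) by exact: cts_fun.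
by move=> /(_ x)/discrete_cvg.
Qed.

Definition mkctsZ (f : X -> int)
    (fc : continuous (f : X -> discrete_topology int)) : ctsZ X :=
  [the continuousType X (discrete_topology int) of mkcts fc].

Lemma ctsZ_map2_subproof (op : int -> int -> int) f g :
  continuous ((fun x => op (f x) (g x)) : X -> discrete_topology int).
Proof.
apply: locally_constant_cts => x.
by apply: filterS2 (ctsZ_near f x) (ctsZ_near g x) => y -> ->.
Qed.

Definition ctsZ_map2 (op : int -> int -> int) f g : ctsZ X :=
  mkctsZ (@ctsZ_map2_subproof op f g).

Definition ctsZ_cst (n : int) : ctsZ X :=
  [the continuousType X (discrete_topology int) of cst (n : discrete_topology int)].

Definition ctsZ_add := ctsZ_map2 +%R.
Definition ctsZ_opp f := ctsZ_map2 (fun _ n => - n) f f.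

Lemma ctsZ_addA : associative ctsZ_add.
Proof. by move=> f g h; apply: ctsZP => x; exact: addrA. Qed.
Lemma ctsZ_addC : commutative ctsZ_add.
Proof. by move=> f g; apply: ctsZP => x; exact: addrC. Qed.
Lemma ctsZ_add0 : left_id (ctsZ_cst 0) ctsZ_add.
Proof. by move=> f; apply: ctsZP => x; exact: add0r. Qed.
Lemma ctsZ_addN : left_inverse (ctsZ_cst 0) ctsZ_opp ctsZ_add.
Proof. by move=> f; apply: ctsZP => x; exact: addNr. Qed.

HB.instance Definition _ := GRing.isZmodule.Build (ctsZ X)
  ctsZ_addA ctsZ_addC ctsZ_add0 ctsZ_addN.

Definition ctsZ_le f g : bool := `[< forall x, f x <= g x >].

Lemma ctsZ_le_refl : reflexive ctsZ_le.
Proof. by move=> f; apply/asboolP => x. Qed.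
Lemma ctsZ_le_anti : antisymmetric ctsZ_le.
Proof.
move=> f g /andP[/asboolP fg /asboolP gf].
by apply: ctsZP => x; apply: le_anti; rewrite fg gf.
Qed.
Lemma ctsZ_le_trans : transitive ctsZ_le.
Proof.
move=> g f h /asboolP fg /asboolP gh.
by apply/asboolP => x; exact: le_trans (fg x) (gh x).
Qed.

HB.instance Definition _ := Order.Le_isPOrder.Build ring_display (ctsZ X)
  ctsZ_le_refl ctsZ_le_anti ctsZ_le_trans.

Lemma ctsZ_leP f g : reflect (forall x, f x <= g x) (f <= g).
Proof. exact: asboolP. Qed.

Definition ctsZ_meet := ctsZ_map2 Order.meet.
Definition ctsZ_join := ctsZ_map2 Order.join.

Lemma ctsZ_meetP f g h : (f <= ctsZ_meet g h) = (f <= g) && (f <= h).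
Proof.
apply/ctsZ_leP/andP => [fgh|[/ctsZ_leP fg /ctsZ_leP fh] x].
  by split; apply/ctsZ_leP => x; move: (fgh x); rewrite lexI => /andP[].
by rewrite [leRHS]/= lexI fg fh.
Qed.

Lemma ctsZ_joinP f g h : (ctsZ_join f g <= h) = (f <= h) && (g <= h).
Proof.
apply/ctsZ_leP/andP => [fgh|[/ctsZ_leP fh /ctsZ_leP gh] x].
  by split; apply/ctsZ_leP => x; move: (fgh x); rewrite leUx => /andP[].
by rewrite [leLHS]/= leUx fh gh.
Qed.

Lemma ctsZ_leD2l h f g : f <= g -> h + f <= h + g.
Proof.
move=> /ctsZ_leP fg; apply/ctsZ_leP => x.
by change (h x + f x <= h x + g x); rewrite lerD2l; exact: fg.
Qed.

HB.instance Definition _ := isLGroup.Build (ctsZ X)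
  ctsZ_meetP ctsZ_joinP ctsZ_leD2l.

Lemma ctsZ_mulrn f n x : (f *+ n) x = f x *+ n.
Proof. by elim: n => [|n IHn] //; rewrite !mulrS -IHn. Qed.

Lemma ctsZ_bounded f : compact [set: X] -> exists n : nat, forall x, `|f x| <= n%:Z.
Proof.
move=> /compact_near_coveringP/(_ nat \oo (fun n x => `|f x| <= n%:Z)).
case=> [x _|n _ /(_ n (leqnn n)) fn]; last by exists n => x; exact: fn.
exists ([set y | f y = f x], [set n | (`|f x| <= n)%N]).
  by split; [exact: ctsZ_near | exists `|f x|%N].
by case=> y n [/= -> ?]; rewrite -abszE lez_nat.
Qed.

Lemma singular_ctsZ (p : int -> bool) f :
  singular (ctsZ_map2 (fun n _ => (p n : nat)%:Z) f f).
Proof.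
split=> [|a /ctsZ_leP a0 /ctsZ_leP ap]; first by apply/ctsZ_leP => x /=.
apply: ctsZP => x; move: (a0 x) (ap x).
change (0 <= a x -> a x <= (p (f x) : nat)%:Z ->
  (a x `&` ((p (f x) : nat)%:Z - a x))%O = 0).
rewrite meetEtotal.
by move: (a x) (p (f x)) => n [] /=; lia.
Qed.

Lemma specker_ctsZ : compact [set: X] -> specker (ctsZ X).
Proof.
move=> cX; apply/seteqP; split=> // f _ H [/= [H0 HB] sH].
have {}H0 : H 0 by exact: set_mem.
have {}HB g h : H g -> H h -> H (g - h).
  by move=> Hg Hh; apply: set_mem; apply: HB; exact: mem_set.
have [n] := ctsZ_bounded f cX; elim: n f => [|n IHn] f fn.
  suff -> : f = 0 by [].
  by apply: ctsZP => x; apply/eqP; rewrite -normr_le0 fn.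
pose p := ctsZ_map2 (fun n _ => ((0 < n)%R : nat)%:Z) f f.
pose m := ctsZ_map2 (fun n _ => ((n < 0)%R : nat)%:Z) f f.
have -> : f = (f - p + m) - (m - p) by rewrite opprB -addrA [m + _]addrC !subrK.
apply: (HB); last by apply: (HB); apply: sH; exact: singular_ctsZ.
apply: IHn => x; move: (fn x).
change (`|f x| <= n.+1%:Z ->
  `|f x - ((0 < f x)%R : nat)%:Z + ((f x < 0)%R : nat)%:Z| <= n%:Z).
by move: (f x) => k; lia.
Qed.

Lemma is_unit_ctsZ f : compact [set: X] -> (forall x, 0 < f x) -> is_unit f.
Proof.
move=> cX f0; split=> [|g]; first by apply/ctsZ_leP => x; exact: ltW.
have [n gn] := ctsZ_bounded g cX; exists n.+1 => //; apply/ctsZ_leP => x.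
suff key (a b : int) : `|a| <= n%:Z -> 0 < b -> (a `|` - a)%O <= b *+ n.+1.
  by move: (key (g x) (f x) (gn x) (f0 x)); rewrite -ctsZ_mulrn.
move=> an b0; rewrite joinEtotal -mulr_natr natz.
have /le_trans : Num.max a (- a) <= n.+1%:Z by lia.
by apply; rewrite ler_peMl.
Qed.

End CtsZ.

Definition boolean_space (X : topologicalType) : Prop :=
  [/\ totally_disconnected [set: X], compact [set: X] & hausdorff_space X].

Record boolean_multispace := BooleanMultispace {
  bms_space :> topologicalType;
  bms_mult : ctsZ bms_space;
  bms_boolean : boolean_space bms_space;
  bms_mult_gt0 : forall x, 0 < bms_mult x
}.
Arguments bms_mult : clear implicits.

Record bms_hom (X Y : boolean_multispace) := BmsHom {
  bms_fun :> X -> Y;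
  bms_cts : continuous bms_fun;
  bms_dvd : forall x, (bms_mult Y (bms_fun x) %| bms_mult X x)%Z
}.

Lemma bms_hom_eq X Y (f g : bms_hom X Y) : f =1 g -> f = g.
Proof.
case: f g => [f fc fd] [g gc gd] /= /funext fg; rewrite -fg in gc gd *.
by congr BmsHom; exact: Prop_irrelevance.
Qed.

Definition bms_id (X : boolean_multispace) : bms_hom X X :=
  @BmsHom X X idfun (fun x => @cvg_id _ _) (fun x => dvdzz _).

Lemma bms_comp_cts (X Y Z : boolean_multispace)
  (f : bms_hom X Y) (g : bms_hom Y Z) : continuous (g \o f).
Proof. by move=> x; apply: continuous_comp; exact: bms_cts. Qed.

Lemma bms_comp_dvd (X Y Z : boolean_multispace)
  (f : bms_hom X Y) (g : bms_hom Y Z) x :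
  (bms_mult Z ((g \o f) x) %| bms_mult X x)%Z.
Proof. exact: dvdz_trans (bms_dvd g (f x)) (bms_dvd f x). Qed.

Definition Bms : category.
Proof.
refine (@Category boolean_multispace bms_hom bms_id
  (fun X Y Z f g => BmsHom (bms_comp_cts (f := f) (g := g))
                           (bms_comp_dvd f g)) _ _ _).
- by move=> X Y f; exact: bms_hom_eq.
- by move=> X Y f; exact: bms_hom_eq.
- by move=> X Y Z W f g h; exact: bms_hom_eq.
Defined.

Lemma bms_compact (X : boolean_multispace) : compact [set: X].
Proof. by case: (bms_boolean X). Qed.

Definition S_obj (X : boolean_multispace) : unital_specker :=
  @UnitalSpecker (ctsZ X) (bms_mult X) (specker_ctsZ (@bms_compact X))
    (is_unit_ctsZ (@bms_compact X) (@bms_mult_gt0 X)).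

Section SMor.
Context (W V : boolean_multispace) (gamma : bms_hom W V).

Lemma S_mor_cts (f : ctsZ V) :
  continuous ((fun w => f (gamma w) *
    (bms_mult W w %/ bms_mult V (gamma w))%Z) : W -> discrete_topology int).
Proof.
apply: locally_constant_cts => w.
have near_gamma (g : ctsZ V) : \forall y \near w, g (gamma y) = g (gamma w).
  exact: (bms_cts (ctsZ_near g (gamma w))).
by apply: filterS3 (near_gamma f) (near_gamma (bms_mult V))
  (ctsZ_near (bms_mult W) w) => y -> -> ->.
Qed.

(* the integer division is exact by [bms_dvd] *)
Definition S_mor_fun (f : S_obj V) : S_obj W := mkctsZ (S_mor_cts (f := f)).

Lemma S_mor_lhom : is_unital_lhom S_mor_fun.
Proof.
have q0 w : 0 <= (bms_mult W w %/ bms_mult V (gamma w))%Z.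
  by rewrite divz_ge0 ?bms_mult_gt0 // ltW // bms_mult_gt0.
split=> [f g|f g|f g|]; apply: ctsZP => w.
- exact: mulrDl.
- transitivity ((f (gamma w) `&` g (gamma w))%O *
    (bms_mult W w %/ bms_mult V (gamma w))%Z); first by [].
  by rewrite meetEtotal minr_pMl // -meetEtotal.
- transitivity ((f (gamma w) `|` g (gamma w))%O *
    (bms_mult W w %/ bms_mult V (gamma w))%Z); first by [].
  by rewrite joinEtotal maxr_pMl // -joinEtotal.
- transitivity (bms_mult V (gamma w) *
    (bms_mult W w %/ bms_mult V (gamma w))%Z); first by [].
  by rewrite mulrC divzK // bms_dvd.
Qed.

Definition S_mor : unital_lhom (S_obj V) (S_obj W) := UnitalLHom S_mor_lhom.

End SMor.

Lemma S_mor1 (X : Bms) : S_mor (idm X) = idm (S_obj X : uSlg).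
Proof.
apply: unital_lhom_eq => f; apply: ctsZP => x.
transitivity (f x * (bms_mult X x %/ bms_mult X x)%Z); first by [].
by rewrite divzz gt_eqF ?bms_mult_gt0 // mulr1.
Qed.

Lemma S_morM (X Y Z : Bms) (f : hom X Y) (g : hom Y Z) :
  S_mor (comp f g) = comp (S_mor g : hom (S_obj Z : uSlg) (S_obj Y)) (S_mor f).
Proof.
apply: unital_lhom_eq => h; apply: ctsZP => x.
transitivity (h (g (f x)) * (bms_mult X x %/ bms_mult Z (g (f x)))%Z);
  first by [].
transitivity (h (g (f x)) * (bms_mult Y (f x) %/ bms_mult Z (g (f x)))%Z *
  (bms_mult X x %/ bms_mult Y (f x))%Z); last by [].
rewrite -mulrA; congr (_ * _).
by rewrite mulrC mulz_divA ?divzK // bms_dvd.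
Qed.

Definition S_functor : functor Bms (opposite uSlg) :=
  @Functor Bms (opposite uSlg) S_obj (fun W V gamma => S_mor gamma) S_mor1 S_morM.

(* Main.v *)
From mathcomp Require Import all_boot all_order all_algebra.
From mathcomp Require Import all_classical.
From mathcomp Require Import topology.
From mathcomp Require Import zify.
Require Import Defs.

Set Implicit Arguments.
Unset Strict Implicit.
Unset Printing Implicit Defensive.

Import Order.TTheory GRing.Theory Num.Theory.

Local Open Scope classical_set_scope.
Local Open Scope ring_scope.

(** The functor is fully faithful and essentially surjective. The spectrum of
[(G, u)] is the set of homomorphisms [chi : G -> Z] of l-groups that send
singular elements into [{0, 1}] and satisfy [chi u > 0], as a subspace of a
product of finite discrete sets, with multiplicity [chi u]. Evaluation
[G -> C_X] is injective because an ultrafilter of nonzero singular elements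
below a singular [s <> 0] yields a [chi] with [chi s = 1], and surjective by a
lattice form of the Stone-Weierstrass theorem. For fullness, given
[psi : C_V -> C_W] and [w], compactness yields a unique [v] such that
[f v = 0] implies [psi f w = 0]; hence [u_V(v) * psi f w = f v * u_W(w)], and
[f = 1] shows that [u_V(v)] divides [u_W(w)]. *)

(** * A criterion for an equivalence of categories *)

Lemma fully_faithful_essentially_surjective (C D : category)
    (F : functor C D) :
  (forall a b (g : hom (F a) (F b)), exists f : hom a b, fmap F f = g) ->
  (forall a b (f g : hom a b), fmap F f = fmap F g -> f = g) ->
  (forall d : D, exists c (i : hom (F c) d), is_iso i) ->
  is_equivalence F.
Proof.
move=> full faith esurj.
pose g d : C := sval (cid (esurj d)).
pose e d : hom (F (g d)) d := sval (cid (svalP (cid (esurj d)))).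
have eP d : is_iso (e d) := svalP (cid (svalP (cid (esurj d)))).
pose e' d : hom d (F (g d)) := sval (cid (eP d)).
have ee' d : comp (e d) (e' d) = idm _ := proj1 (svalP (cid (eP d))).
have e'e d : comp (e' d) (e d) = idm _ := proj2 (svalP (cid (eP d))).
pose lift a b (h : hom (F a) (F b)) : hom a b := sval (cid (full a b h)).
have liftK a b h : fmap F (@lift a b h) = h := svalP (cid (full a b h)).
(* The quasi-inverse conjugates by the chosen isomorphisms and lifts along [F]; faithfulness reduces
   its functor laws to identities in [D]. *)
pose gm a b (h : hom a b) := lift _ _ (comp (e a) (comp h (e' b))).
have gm1 a : gm _ _ (idm a) = idm (g a).
  by apply: faith; rewrite liftK comp1m ee' fmap1.
have gmM a b c (h : hom a b) (k : hom b c) :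
    gm _ _ (comp h k) = comp (gm _ _ h) (gm _ _ k).
  apply: faith; rewrite fmapM !liftK -!compA.
  by rewrite (compA (e' b)) e'e comp1m.
pose H : functor D C := Functor gm1 gmM.
exists H; split.
  (* The unit at [a] lifts the inverse isomorphism at [F a]; the counit is [e] itself. *)
  exists (fun a => lift a (g (F a)) (e' (F a))); split=> [a|a b f].
    exists (lift (g (F a)) a (e (F a))).
    by split; apply: faith; rewrite fmapM !liftK fmap1 ?e'e ?ee'.
  apply: faith; rewrite !fmapM /= /comp_fmap /= !liftK.
  by rewrite (compA (e' _)) e'e comp1m.
exists e; split=> [d|a b f]; first exact: eP.
by rewrite /= /comp_fmap /= liftK -!compA e'e compm1.
Qed.

(** * Polars, singular elements and local values in l-groups *)

Section LGroupTheory.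
Context (G : lgroupType).
Implicit Types a b c g h s t x y z : G.

Lemma lgroup_leD a b x y : a <= b -> x <= y -> a + x <= b + y.
Proof.
move=> ab xy; apply: (le_trans (lgroup_leD2l a _ _ xy)).
by rewrite ![_ + y]addrC; exact: lgroup_leD2l.
Qed.

Lemma lgroup_leN x y : x <= y -> - y <= - x.
Proof.
by move=> /(lgroup_leD2l (- x - y) _ _); rewrite addrAC addNr add0r addrNK.
Qed.

Lemma lgroup_subr_ge0 x y : (0 <= y - x) = (x <= y).
Proof.
apply/idP/idP => [/(lgroup_leD2l x _ _)|/(lgroup_leD2l (- x) _ _)].
  by rewrite addr0 addrC addrNK.
by rewrite addNr addrC.
Qed.

Lemma lgroup_addr_ge0 x y : 0 <= x -> 0 <= y -> 0 <= x + y.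
Proof. by move=> x0 y0; rewrite -[0]addr0; exact: lgroup_leD. Qed.

Lemma lgroup_lerDl x y : 0 <= y -> x <= x + y.
Proof. by move=> y0; rewrite -[leLHS]addr0; exact: lgroup_leD. Qed.

Lemma lgroup_lerBl x y : 0 <= y -> x - y <= x.
Proof. by move=> y0; rewrite -lgroup_subr_ge0 opprB addrC addrNK. Qed.

Lemma lmeetl x y : lmeet x y <= x.
Proof. by have := lexx (lmeet x y); rewrite lmeetP => /andP[]. Qed.

Lemma lmeetr x y : lmeet x y <= y.
Proof. by have := lexx (lmeet x y); rewrite lmeetP => /andP[]. Qed.

Lemma lmeetC x y : lmeet x y = lmeet y x.
Proof. by apply: le_anti; rewrite !lmeetP !lmeetl !lmeetr. Qed.

Lemma lmeet_idPl x y : x <= y -> lmeet x y = x.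
Proof. by move=> xy; apply: le_anti; rewrite lmeetl lmeetP lexx xy. Qed.

Lemma lmeet_mono x y a b : x <= a -> y <= b -> lmeet x y <= lmeet a b.
Proof.
move=> xa yb; rewrite lmeetP (le_trans (lmeetl x y) xa).
exact: le_trans (lmeetr x y) yb.
Qed.

Lemma lmeetDr x y z : lmeet (x + z) (y + z) = lmeet x y + z.
Proof.
apply: le_anti; apply/andP; split.
  rewrite -[leLHS](subrK z); apply: lgroup_leD => //.
  rewrite lmeetP; apply/andP; split.
    by rewrite -[leRHS](addrK z); apply: lgroup_leD => //; exact: lmeetl.
  by rewrite -[leRHS](addrK z); apply: lgroup_leD => //; exact: lmeetr.
by rewrite lmeetP; apply/andP; split; apply: lgroup_leD => //;
  [exact: lmeetl | exact: lmeetr].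
Qed.

Lemma ljoinN x y : ljoin x y = - lmeet (- x) (- y).
Proof.
apply: le_anti; apply/andP; split.
  rewrite ljoinP; apply/andP; split.
    by rewrite -[leLHS]opprK; apply: lgroup_leN; exact: lmeetl.
  by rewrite -[leLHS]opprK; apply: lgroup_leN; exact: lmeetr.
rewrite -[leRHS]opprK; apply: lgroup_leN.
have := lexx (ljoin x y); rewrite ljoinP => /andP[? ?].
by rewrite lmeetP; apply/andP; split; exact: lgroup_leN.
Qed.

Lemma lmeet_eq0_mono x y a b : 0 <= x -> 0 <= y -> x <= a -> y <= b ->
  lmeet a b = 0 -> lmeet x y = 0.
Proof.
move=> x0 y0 xa yb ab0; apply: le_anti.
by rewrite -{1}ab0 lmeet_mono //= lmeetP x0.
Qed.

(** With [m] the meet of [a + b] and [t], [m - b] lies below both [a] and [t], hence below 0; so [m]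
    lies below [b] and [t]. *)
Lemma lmeet_eq0D a b t : 0 <= a -> 0 <= b -> 0 <= t ->
  lmeet a t = 0 -> lmeet b t = 0 -> lmeet (a + b) t = 0.
Proof.
move=> a0 b0 t0 at0 bt0; apply: le_anti; apply/andP; split; last first.
  by rewrite lmeetP t0 lgroup_addr_ge0.
rewrite -[leRHS]bt0 lmeetP lmeetr andbT -[leLHS](subrK b) -[leRHS]add0r.
apply: lgroup_leD => //; rewrite -[leRHS]at0 lmeetP; apply/andP; split.
  rewrite -[leRHS](addrK b); apply: lgroup_leD; [exact: lmeetl|exact: lexx].
exact: le_trans (lgroup_lerBl _ b0) (lmeetr _ _).
Qed.

(* The bound [a] plays the role of [|g|]. *)
Definition polar t : set G :=
  [set g | exists a, [/\ 0 <= a, lmeet a t = 0, - a <= g & g <= a]].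

Lemma polar_pos t g : 0 <= g -> lmeet g t = 0 -> polar t g.
Proof.
move=> g0 gt0; exists g; split=> //; apply: (le_trans _ g0).
by rewrite -oppr0; exact: lgroup_leN.
Qed.

Lemma polar0 t : 0 <= t -> polar t 0.
Proof. by move=> t0; apply: polar_pos => //; exact: lmeet_idPl. Qed.

Lemma polarN t g : polar t g -> polar t (- g).
Proof.
move=> [a [a0 at0 ag ga]]; exists a; split=> //; first exact: lgroup_leN.
by rewrite -[leRHS]opprK; exact: lgroup_leN.
Qed.

Lemma polarD t g h : 0 <= t -> polar t g -> polar t h -> polar t (g + h).
Proof.
move=> t0 [a [a0 at0 ag ga]] [b [b0 bt0 bh hb]].
exists (a + b); split; [exact: lgroup_addr_ge0 | exact: lmeet_eq0D | |].
  by rewrite opprD; exact: lgroup_leD.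
exact: lgroup_leD.
Qed.

Lemma polarMz t g n : 0 <= t -> polar t g -> polar t (g *~ n).
Proof.
move=> t0 gt.
have nat_case m : polar t (g *+ m).
  elim: m => [|m IHm]; first exact: polar0.
  by rewrite mulrS; exact: polarD.
case: n => m /=; first exact: nat_case.
by rewrite NegzE mulrNz; exact/polarN/nat_case.
Qed.

Lemma polar_mono t t' g : 0 <= t' -> t' <= t -> polar t g -> polar t' g.
Proof.
move=> t0 t't [a [a0 at0 ag ga]]; exists a; split=> //.
exact: lmeet_eq0_mono at0.
Qed.

(** Meets respect congruence modulo a polar: changing the arguments by at most [a] and [b] changes
    the meet by at most [a + b]. *)
Lemma polar_meet t g g' h h' : 0 <= t ->
  polar t (g - g') -> polar t (h - h') -> polar t (lmeet g h - lmeet g' h').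
Proof.
move=> t0 [a [a0 at0 ag ga]] [b [b0 bt0 bh hb]].
have shift x x' c d : 0 <= d -> x - x' <= c -> x <= x' + (c + d).
  move=> d0 xc; rewrite -[leLHS](subrK x') addrC; apply: lgroup_leD => //.
  exact: le_trans xc (lgroup_lerDl _ d0).
have meet_shift x x' y y' : x - x' <= a -> y - y' <= b ->
    lmeet x y - lmeet x' y' <= a + b.
  move=> xa yb; rewrite -[leRHS](addKr (lmeet x' y')) addrC.
  apply: lgroup_leD => //; rewrite -lmeetDr.
  apply: lmeet_mono; first exact: shift.
  by rewrite [a + b]addrC; exact: shift.
exists (a + b); split; [exact: lgroup_addr_ge0 | exact: lmeet_eq0D | |].
  rewrite -[leRHS]opprB; apply: lgroup_leN; apply: meet_shift.
    by rewrite -opprB -[leRHS]opprK; exact: lgroup_leN.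
  by rewrite -opprB -[leRHS]opprK; exact: lgroup_leN.
exact: meet_shift.
Qed.

Lemma singular_ge0 s : singular s -> 0 <= s.
Proof. by case. Qed.

Lemma singular_le s t : singular s -> 0 <= t -> t <= s -> singular t.
Proof.
move=> [s0 sP] t0 ts; split=> // a a0 at_.
apply: (lmeet_eq0_mono a0 _ (lexx a) _ (sP a a0 (le_trans at_ ts))).
  by rewrite lgroup_subr_ge0.
exact: lgroup_leD.
Qed.

Lemma singular_meet_sub s t : singular s -> 0 <= t -> t <= s ->
  lmeet (s - t) t = 0.
Proof. by move=> [_ sP] t0 ts; rewrite lmeetC; exact: sP. Qed.

Lemma lgroup_mulrz_le t n m : 0 <= t -> n <= m -> t *~ n <= t *~ m.
Proof.
move=> t0 nm; rewrite -lgroup_subr_ge0 -mulrzBr.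
have : 0 <= m - n by rewrite subr_ge0.
case: (m - n) => // k _; rewrite -pmulrn; elim: k => [|k IHk] //.
by rewrite mulrS; exact: lgroup_addr_ge0.
Qed.

(* On the part of the spectrum where [t] does not vanish, [g] equals [n * t]. *)
Definition local_value t g n := polar t (g - t *~ n).

Lemma local_valueB t g h n m : 0 <= t ->
  local_value t g n -> local_value t h m -> local_value t (g - h) (n - m).
Proof.
move=> t0 gn hm; rewrite /local_value mulrzBr.
have -> : g - h - (t *~ n - t *~ m) = (g - t *~ n) - (h - t *~ m).
  by rewrite !opprD !opprK addrACA.
by apply: polarD => //; exact: polarN.
Qed.

(** As [0 <= t], the multiples of [t] form a chain, ordered like their coefficients. *)
Lemma local_value_meet t g h n m : 0 <= t ->
  local_value t g n -> local_value t h m ->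
  local_value t (lmeet g h) (Num.min n m).
Proof.
move=> t0 gn hm; rewrite /local_value.
suff -> : t *~ Num.min n m = lmeet (t *~ n) (t *~ m) by exact: polar_meet.
wlog nm : n m {gn hm} / n <= m => [wl|].
  by have [/wl//|/wl] := orP (le_total n m); rewrite minC lmeetC.
by rewrite (min_idPl nm) lmeet_idPl // lgroup_mulrz_le.
Qed.

(** The difference [g - t *~ n] splits into [g - s *~ n], in the larger polar of the smaller [t],
    and a multiple of [s - t], disjoint from [t] because [s] is singular. *)
Lemma local_value_le s t g n : singular s -> 0 <= t -> t <= s ->
  local_value s g n -> local_value t g n.
Proof.
move=> sS t0 ts gn; rewrite /local_value.
rewrite -[g](subrK (s *~ n)) -addrA -mulrzBl.
apply: polarD => //; first exact: polar_mono gn.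
apply: polarMz => //; apply: polar_pos; first by rewrite lgroup_subr_ge0.
exact: singular_meet_sub.
Qed.

(** Two values put [t *~ (n - m)] in the polar of [t]. If [n != m], then [t] lies below the absolute
    value of this multiple, hence below an element disjoint from [t], so [t = 0]. *)
Lemma local_value_uniq t g n m : 0 <= t -> t != 0 ->
  local_value t g n -> local_value t g m -> n = m.
Proof.
move=> t0 tn0 gn gm; apply/eqP; rewrite -subr_eq0; apply/negP => /negP nm.
have := local_valueB t0 gn gm; rewrite /local_value subrr sub0r.
case=> a [a0 at0 ag ga]; move/negP: tn0; apply; apply/eqP.
rewrite -(at0) lmeetC lmeet_idPl //.
have [k0|k0] := leP 0 (n - m).
  have : t *~ (n - m) <= a.
    by rewrite -[leRHS]opprK -[leLHS]opprK; exact: lgroup_leN.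
  by apply: le_trans; rewrite -[leLHS]mulr1z; apply: lgroup_mulrz_le => //; lia.
apply: le_trans ga; rewrite -mulrNz -[leLHS]mulr1z.
by apply: lgroup_mulrz_le => //; lia.
Qed.

Lemma local_value1 s t : singular s -> 0 <= t -> t <= s -> local_value t s 1.
Proof.
move=> sS t0 ts; rewrite /local_value mulr1z; apply: polar_pos.
  by rewrite lgroup_subr_ge0.
exact: singular_meet_sub.
Qed.

Lemma local_value0 s t : 0 <= s -> lmeet s t = 0 -> local_value t s 0.
Proof. by move=> s0 st; rewrite /local_value subr0; exact: polar_pos. Qed.

Lemma specker_ind (P : G -> Prop) : specker G -> P 0 ->
  (forall x y, P x -> P y -> P (x - y)) ->
  (forall s, singular s -> P s) -> forall g, P g.
Proof.
move=> spG P0 PB Ps g.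
have : smallest [set H : set G | zmod_closed (mem H)] (@singular G) g.
  by rewrite spG.
apply; split=> //; split; first by rewrite inE.
by move=> x y; rewrite !inE; exact: PB.
Qed.

End LGroupTheory.

(** * Elementary facts on additive maps *)

Section AdditiveMap.
Context (U V : zmodType) (f : U -> V) (fD : {morph f : x y / x + y}).

Lemma additive0 : f 0 = 0.
Proof. by apply: (addrI (f 0)); rewrite -fD !addr0. Qed.

Lemma additiveN x : f (- x) = - f x.
Proof. by apply: (addrI (f x)); rewrite -fD !subrr additive0. Qed.

Lemma additiveMn x n : f (x *+ n) = f x *+ n.
Proof.
elim: n => [|n IHn]; first by rewrite additive0.
by rewrite !mulrS fD IHn.
Qed.

Lemma additiveMz x n : f (x *~ n) = f x *~ n.
Proof.
case: n => n; first by rewrite -!pmulrn additiveMn.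
by rewrite NegzE !mulrNz -!pmulrn additiveN additiveMn.
Qed.

End AdditiveMap.

(** * Integer-valued points of a unital Specker l-group *)

Section Points.
Context (G : unital_specker).
Local Notation u := (us_unit G).

(** The clause on singular elements fixes the scale, as positive multiples of a point are
    homomorphisms too; the clause on the unit excludes the zero map. *)
Record is_point (chi : G -> int) : Prop := IsPoint {
  pointD : {morph chi : x y / x + y};
  point_meet : forall x y, chi (lmeet x y) = Num.min (chi x) (chi y);
  point_singular : forall s, singular s -> chi s = 0 \/ chi s = 1;
  point_unit_gt0 : 0 < chi u
}.

Section PointTheory.
Context (chi : G -> int) (chiP : is_point chi).

Lemma point0 : chi 0 = 0.
Proof. exact: additive0 (pointD chiP). Qed.

Lemma pointN x : chi (- x) = - chi x.
Proof. exact: additiveN (pointD chiP) x. Qed.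

Lemma pointMz x n : chi (x *~ n) = chi x *~ n.
Proof. exact: additiveMz (pointD chiP) x n. Qed.

Lemma point_join x y : chi (ljoin x y) = Num.max (chi x) (chi y).
Proof.
rewrite ljoinN pointN (point_meet chiP) !pointN; lia.
Qed.

End PointTheory.

(** Small elements [t] act as clopen sets around the desired point: [chi g] is the local value of
    [g] at almost every [t] for an ultrafilter. *)
Lemma point_of_singular (s0 : G) : singular s0 -> s0 != 0 ->
  exists2 chi, is_point chi & chi s0 = 1.
Proof.
move=> s0S s0n0.
pose small (t : G) := [/\ singular t, t != 0 & t <= s0].
(* Each member of [l] is constant, 0 or 1, on [t]. The filter [F] makes every finite list of
   singular elements eventually decided. *)
pose decides (l : seq G) (t : G) :=
  forall s, s \in l -> local_value t s 0 \/ local_value t s 1.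
pose F := [set A : set G | exists2 l : seq G,
  (forall s, s \in l -> singular s) & forall t, small t -> decides l t -> A t].
have F_filter : ProperFilter F.
  split; [|split].
  - move=> [l lS] /(_ _ _ _) F0.
    suff [t tS /(F0 t tS)] : exists2 t, small t & decides l t by [].
    (* A small [t] deciding the tail is kept if it is disjoint from [s]; otherwise it is cut down to
       [lmeet s t], where [s] has value 1. *)
    elim: l lS {F0} => [|s l IHl] lS; first by exists s0.
    have [|t [tS tn0 ts0] tl] := IHl.
      by move=> s' /= s'l; apply: lS; rewrite inE s'l orbT.
    have sS : singular s by apply: lS; rewrite inE eqxx.
    have t0 := singular_ge0 tS.
    have m0 : 0 <= lmeet s t by rewrite lmeetP t0 singular_ge0.
    have [st0|stn0] := eqVneq (lmeet s t) 0.
      exists t => // s'; rewrite inE => /orP[/eqP->|]; last exact: tl.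
      by left; apply: local_value0 => //; exact: singular_ge0.
    exists (lmeet s t).
      split=> //; last exact: le_trans (lmeetr _ _) ts0.
      by apply: (singular_le tS) => //; exact: lmeetr.
    move=> s'; rewrite inE => /orP[/eqP->|/tl].
      by right; apply: local_value1 => //; exact: lmeetl.
    by case=> h; [left|right]; apply: (local_value_le tS) => //; exact: lmeetr.
  - by exists [::].
  - move=> A B [l lS lA] [l' l'S l'B]; exists (l ++ l').
      by move=> s; rewrite mem_cat => /orP[/lS|/l'S].
    move=> t tS tl; split.
      by apply: lA => // s sl; apply: tl; rewrite mem_cat sl.
    by apply: l'B => // s sl; apply: tl; rewrite mem_cat sl orbT.
  - by move=> A B AB [l lS lA]; exists l => // t tS tl; exact/AB/lA.
have [U [U_ultra FU]] := ultraFilterLemma F_filter.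
have U_small : U small by apply: FU; exists [::].
pose value g n := U [set t | local_value t g n].
have value_uniq g n m : value g n -> value g m -> n = m.
  move=> gn gm.
  have [t [[[tS tn0 _] tn] tm]] := filter_ex (filterI (filterI U_small gn) gm).
  exact: local_value_uniq (singular_ge0 tS) tn0 tn tm.
have valueB g h n m : value g n -> value h m -> value (g - h) (n - m).
  move=> gn hm; apply: filterS3 U_small gn hm => t [tS _ _].
  exact: local_valueB (singular_ge0 tS).
have value_singular s : singular s -> value s 0 \/ value s 1.
  move=> sS; have Us : U [set t | local_value t s 0 \/ local_value t s 1].
    apply: FU; exists [:: s] => [s'|t tS]; first by rewrite inE => /eqP->.
    by apply; rewrite inE.
  (* The ultrafilter selects one of the two alternatives. *)
  have [|N0] := in_ultra_setVsetC [set t | local_value t s 0] U_ultra.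
    by left.
  by right; apply: filterS2 Us N0 => t [].
have value_ex g : exists n, value g n.
  move: g; apply: (specker_ind (us_specker G)) =>
    [|x y [n xn] [m ym]|s /value_singular[]].
  - exists 0; apply: filterS U_small => t [tS _ _].
    by rewrite /= /local_value subr0; apply: polar0; exact: singular_ge0.
  - by exists (n - m); exact: valueB.
  - by exists 0.
  - by exists 1.
have [chi chiE] := choice value_ex.
have chiB x y : chi (x - y) = chi x - chi y.
  by apply: (value_uniq (x - y)) => //; exact: valueB.
have chi0 : chi 0 = 0 by have := chiB 0 0; rewrite !subrr.
have chiD x y : chi (x + y) = chi x + chi y.
  by rewrite -{1}[y]opprK chiB -[- y]sub0r chiB chi0 opprB subr0.
have chi_meet x y : chi (lmeet x y) = Num.min (chi x) (chi y).
  apply: (value_uniq (lmeet x y)) => //.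
  apply: filterS3 U_small (chiE x) (chiE y) => t [tS _ _].
  exact: local_value_meet (singular_ge0 tS).
have chi_s0 : chi s0 = 1.
  apply: (value_uniq s0) => //; apply: filterS U_small => t [tS _ ts].
  by apply: local_value1 => //; exact: singular_ge0.
have chi_s s : singular s -> chi s = 0 \/ chi s = 1.
  by move=> /value_singular[h|h]; [left|right]; apply: (value_uniq s).
exists chi => //; split=> //.
(* Positivity at the unit: [s0 <= u *+ n] forces [1 <= n * chi u]. *)
have [_ /(_ s0) [n n0 s0u]] := us_unitP G.
have {}s0u : s0 <= u *+ n.
  apply: le_trans s0u; have := lexx (lgroup_abs s0).
  by rewrite ljoinP => /andP[].
have : chi s0 <= chi (u *+ n).
  by rewrite -(lmeet_idPl s0u) chi_meet; lia.
rewrite (additiveMn chiD) chi_s0 -mulr_natr natz; nia.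
Qed.

(** Each singular element contributes at most 1, so the bound depends only on how [g] is generated.
    It confines each coordinate of the spectrum to a finite set. *)
Lemma point_bounded (g : G) :
  exists N : nat, forall chi, is_point chi -> `|chi g| <= N%:Z.
Proof.
move: g; apply: (specker_ind (us_specker G)) => [|x y [n xn] [m ym]|s sS].
- by exists 0%N => chi chiP; rewrite point0.
- exists (n + m)%N => chi chiP; rewrite (pointD chiP) (pointN chiP).
  have := xn _ chiP; have := ym _ chiP; lia.
- by exists 1%N => chi chiP; have [->|->] := point_singular chiP sS.
Qed.

Lemma point_separates (g h : G) :
  (forall chi, is_point chi -> chi g = chi h) -> g = h.
Proof.
suff le0 x : (forall chi, is_point chi -> chi x = 0) -> x <= 0.
  move=> gh; apply/eqP; rewrite -subr_eq0; apply/eqP/le_anti/andP; split.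
    apply: le0 => chi chiP.
    by rewrite (pointD chiP) (pointN chiP) (gh chi chiP) subrr.
  rewrite -oppr0 -[leRHS]opprK; apply/lgroup_leN/le0 => chi chiP.
  rewrite (pointN chiP) (pointD chiP) (pointN chiP) (gh chi chiP).
  by rewrite subrr oppr0.
(* The positive part [p] of [x] must vanish. A nonzero meet of [p] with a singular element would be
   singular and have value 1 at some point, where [p] has value 0. *)
move=> x0; pose p := ljoin x 0.
have := lexx p; rewrite ljoinP => /andP[xp p0].
have pS s : singular s -> lmeet p s = 0.
  move=> sS; apply/eqP/negP => /negP ps0.
  have psS : singular (lmeet p s).
    apply: (singular_le sS _ (lmeetr _ _)).
    by rewrite lmeetP p0 /=; exact: singular_ge0.
  have [chi chiP] := point_of_singular psS ps0.
  rewrite (point_meet chiP) (point_join chiP) (point0 chiP) x0 //.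
  by have [->|->] := point_singular chiP sS.
(* The singular elements generate the group, so disjointness from [p] passes from them to [p]
   itself. *)
have [a [_ ap _ pa]] : polar p p.
  move: {2}p; apply: (specker_ind (us_specker G)) => [|y z yp zp|s sS].
  - exact: polar0.
  - by apply: polarD => //; exact: polarN.
  - by apply: polar_pos; [exact: singular_ge0 | rewrite lmeetC pS].
by apply: le_trans xp _; rewrite -ap lmeetC lmeet_idPl.
Qed.

End Points.

(** * Compactness arguments and lattice approximation *)

Lemma compact_directed (X : topologicalType) (I : Type) (A : set I)
    (P : I -> X -> Prop) : compact [set: X] -> A !=set0 ->
  (forall i j, A i -> A j ->
    exists2 k, A k & forall x, P i x \/ P j x -> P k x) ->
  (forall x : X, exists2 i, A i & \forall y \near x, P i y) ->
  exists2 i, A i & forall x, P i x.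
Proof.
move=> /compact_near_coveringP cX [i0 Ai0] dir loc.
(* [F] is generated by the sets of indices dominating a given one; it is a filter by directedness,
   and compactness then makes local choices uniform. *)
pose F := filter_from A
  (fun i => [set j | A j /\ forall x : X, P i x -> P j x]).
have F_filter : Filter F.
  apply: filter_from_filter; first by exists i0.
  move=> i j Ai Aj; have [k Ak kP] := dir i j Ai Aj; exists k => //.
  move=> l [Al lP]; do 2!split=> //; move=> x Px; apply: lP; apply: kP.
    by left.
  by right.
have [x _|i Ai /(_ i (conj Ai (fun _ => id))) iP] := cX I F P F_filter.
  have [i Ai ix] := loc x.
  exists ([set y | P i y], [set j | A j /\ forall x : X, P i x -> P j x]).
    by split=> //; exists i.
  by case=> y j [/= yP [_ ]]; apply.
by exists i => // x; exact: iP.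
Qed.

Lemma ctsZ_lmeetE (X : topologicalType) (f g : ctsZ X) x :
  (lmeet f g : ctsZ X) x = Num.min (f x) (g x).
Proof. exact: meetEtotal. Qed.

Lemma ctsZ_ljoinE (X : topologicalType) (f g : ctsZ X) x :
  (ljoin f g : ctsZ X) x = Num.max (f x) (g x).
Proof. exact: joinEtotal. Qed.

(** Continuous integer functions that are equal at a point agree near it, so approximation becomes
    equality. *)
Lemma lattice_stone_weierstrass (X : topologicalType) (A : set (ctsZ X))
    (f : ctsZ X) : compact [set: X] -> A !=set0 ->
  (forall g h, A g -> A h -> A (lmeet g h)) ->
  (forall g h, A g -> A h -> A (ljoin g h)) ->
  (forall x y, exists2 g, A g & g x = f x /\ g y = f y) -> A f.
Proof.
move=> cX A0 AI AU A2.
have near_eq (g : ctsZ X) x : g x = f x -> \forall y \near x, g y = f y.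
  by move=> gf; apply: filterS2 (ctsZ_near f x) (ctsZ_near g x) => y -> ->.
(* Interpolants at [x] and a varying [y] are merged by meets. *)
have below x : exists2 g, A g /\ g x = f x & forall y, g y <= f y.
  apply: (@compact_directed X _ [set g | A g /\ g x = f x]
    (fun g y => g y <= f y) cX).
  - by have [g Ag [gx _]] := A2 x x; exists g.
  - move=> g h [Ag gx] [Ah hx]; exists (lmeet g h).
      by split; [exact: AI | rewrite ctsZ_lmeetE gx hx minxx].
    by move=> y; rewrite ctsZ_lmeetE ge_min => -[->|->] //; rewrite orbT.
  - move=> y; have [g Ag [gx gy]] := A2 x y; exists g => //.
    by apply: filterS (near_eq g y gy) => z ->.
(* Functions below [f] that touch it at a varying point are merged by joins. *)
have [g [Ag gf] fg] : exists2 g, A g /\ (forall y, g y <= f y) &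
    forall y, f y <= g y.
  apply: (@compact_directed X _ [set g | A g /\ forall y, g y <= f y]
    (fun g y => f y <= g y) cX).
  (* On the empty space any member of [A] serves. *)
  - have [[x _]|X0] := pselect ([set: X] !=set0).
      by have [g [Ag _] gf] := below x; exists g.
    by case: A0 => g Ag; exists g; split=> // y; case: X0; exists y.
  - move=> g h [Ag gf] [Ah hf]; exists (ljoin g h).
      by split=> [|y]; [exact: AU | rewrite ctsZ_ljoinE ge_max gf hf].
    by move=> y; rewrite ctsZ_ljoinE le_max => -[->|->] //; rewrite orbT.
  - move=> x; have [g [Ag gx] gf] := below x; exists g => //.
    by apply: filterS (near_eq g x gx) => z ->.
suff -> : f = g by [].
by apply: ctsZP => y; apply: le_anti; rewrite gf fg.
Qed.

Lemma compact_set_type (T : topologicalType) (A : set T) :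
  compact A -> compact [set: A].
Proof.
move=> cA F FF _.
have [|p [Ap pF]] := cA (set_val @ F) _.
  by apply: (@filterE _ F) => x; exact: set_valP.
exists (SigSub (mem_set Ap)); split=> // B C FB.
rewrite nbhsE => -[V [[W oW <-] Wp] VC].
have [|y [[x Bx <-] Wx]] := pF (set_val @` B) W _ (open_nbhs_nbhs (conj oW Wp)).
  by apply: (@filterS _ F _ B) => // x Bx; exists x.
by exists x; split=> //; exact: VC.
Qed.

Lemma zero_dimensional_hausdorff (T : topologicalType) :
  zero_dimensional T -> hausdorff_space T.
Proof.
move=> zT x y xy; apply: contrapT => /eqP /zT [U [[oU cU] Ux Uy]].
have [|z [Uz /=]] := xy U (~` U) (open_nbhs_nbhs (conj oU Ux)); last by [].
by apply: open_nbhs_nbhs; split=> //; exact: closed_openC.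
Qed.

(** * The spectrum and the evaluation isomorphism *)

Section Spectrum.
Context (G : unital_specker).

Definition spectrum : topologicalType :=
  [set chi : prod_topology (fun _ : G => discrete_topology int) | is_point chi].

Definition spectrum_val (x : spectrum) : G -> int := set_val x.

Lemma spectrum_valP x : is_point (spectrum_val x).
Proof. exact: (set_valP x). Qed.

Lemma spectrum_of_point chi : is_point chi ->
  exists x, spectrum_val x = chi.
Proof. by move=> chiP; exists (SigSub (mem_set chiP)). Qed.

Lemma eval_continuous (g : G) :
  continuous ((fun x => spectrum_val x g) : spectrum -> discrete_topology int).
Proof.
have proj_val : continuous
    (@proj G (fun=> discrete_topology int) g \o (set_val : spectrum -> _)).
  move=> x; apply: continuous_comp; first exact: initial_continuous.
  exact: proj_continuous.
exact: proj_val.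
Qed.

Definition eval (g : G) : ctsZ spectrum := mkctsZ (eval_continuous (g := g)).

(** The points form a closed subset of a product of finite boxes: each condition in [is_point]
    involves finitely many coordinates. *)
Lemma spectrum_compact : compact [set: spectrum].
Proof.
apply: compact_set_type.
have [N NP] := choice (@point_bounded G).
pose box (g : G) : set (discrete_topology int) :=
  [set n | `|n : int| <= (N g)%:Z].
have box_compact g : compact (box g).
  apply: finite_compact.
  (* The integers from [- N g] to [N g] are the [k - N g] with [k < 2 * N g + 1]. *)
  apply: sub_finite_set
    (finite_image (fun k : nat => k%:Z - (N g)%:Z) (finite_II (N g).*2.+1)).
  by move=> n; rewrite /box /= => nN; exists (absz (n + (N g)%:Z)) => /=; lia.
apply: (subclosed_compact _ (tychonoff box_compact)); last first.
  by move=> chi chiP g; exact: NP.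
move=> p pcl.
(* The factors are discrete, so fixing finitely many coordinates of [p] defines a neighbourhood. *)
have near_p (l : seq G) :
    exists2 chi, is_point chi & forall g, g \in l -> chi g = p g.
  have : nbhs p [set q | forall g, g \in l -> q g = p g].
    elim: l => [|g l IHl]; first exact: filterE.
    have : nbhs p (proj g @^-1` [set p g]).
      apply: (@proj_continuous G (fun=> discrete_topology int) g p).
      exact: discrete_set1.
    move=> /(filterI IHl); apply: filterS => q [ql qg] h.
    by rewrite inE => /orP[/eqP->|/ql].
  by move=> /pcl[chi [chiP chil]]; exists chi.
split.
- move=> x y; have [chi chiP pE] := near_p [:: x; y; x + y].
  by rewrite -!pE ?inE ?eqxx ?orbT //; exact: pointD.
- move=> x y; have [chi chiP pE] := near_p [:: x; y; lmeet x y].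
  by rewrite -!pE ?inE ?eqxx ?orbT //; exact: point_meet.
- move=> s; have [chi chiP pE] := near_p [:: s].
  by rewrite -!pE ?inE ?eqxx ?orbT //; exact: point_singular.
- have [chi chiP pE] := near_p [:: us_unit G].
  by rewrite -!pE ?inE ?eqxx ?orbT //; exact: point_unit_gt0.
Qed.

Lemma spectrum_zero_dimensional : zero_dimensional spectrum.
Proof.
move=> x y /eqP xy.
have [g xyg] : exists g, spectrum_val x g <> spectrum_val y g.
  apply: contrapT => /forallNP h; apply: xy; apply: val_inj.
  by apply/funext => g; apply: contrapT; exact: h.
exists (eval g @^-1` [set spectrum_val x g]); split=> //=; last by move/esym.
apply: preimage_clopen; last exact: eval_continuous.
by split; [exact: discrete_open | exact: discrete_closed].
Qed.

Lemma spectrum_boolean : boolean_space spectrum.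
Proof.
have zS := spectrum_zero_dimensional.
split; [exact: zero_dimension_totally_disconnected | exact: spectrum_compact
  | exact: zero_dimensional_hausdorff].
Qed.

Definition spectrum_bms : boolean_multispace :=
  @BooleanMultispace spectrum (eval (us_unit G)) spectrum_boolean
    (fun x => point_unit_gt0 (spectrum_valP x)).

Lemma eval_lhom : @is_unital_lhom G (S_obj spectrum_bms) eval.
Proof.
split=> [g h|g h|g h|//]; apply: ctsZP => x.
- exact: pointD (spectrum_valP x) _ _.
- rewrite ctsZ_lmeetE; exact: point_meet (spectrum_valP x) _ _.
- rewrite ctsZ_ljoinE; exact: point_join (spectrum_valP x) _ _.
Qed.

Lemma eval_inj : injective eval.
Proof.
move=> g h gh; apply: point_separates => chi /spectrum_of_point[x <-].
exact: (congr1 (fun f : ctsZ spectrum => f x) gh).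
Qed.

(** By lattice approximation it suffices to interpolate [f] at two points by elements of [G]. *)
Lemma eval_surj (f : ctsZ spectrum) : exists g, eval g = f.
Proof.
have [evD evI evU _] := eval_lhom.
suff : range eval f by case=> g _; exists g.
apply: (lattice_stone_weierstrass spectrum_compact).
- by exists (eval 0); exists 0.
- by move=> _ _ [g _ <-] [h _ <-]; exists (lmeet g h) => //; exact: evI.
- by move=> _ _ [g _ <-] [h _ <-]; exists (ljoin g h) => //; exact: evU.
move=> x y; have xP := spectrum_valP x; have yP := spectrum_valP y.
(* If all singular elements vanished at [z], so would the unit. *)
have nonzero z : exists2 s, singular s & spectrum_val z s = 1.
  apply: contrapT => z0; have zP := spectrum_valP z.
  suff : spectrum_val z (us_unit G) = 0.
    by move=> zu; have := point_unit_gt0 zP; rewrite zu.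
  move: (us_unit G); apply: (specker_ind (us_specker G)).
  - exact: point0.
  - by move=> a b a0 b0; rewrite (pointD zP) (pointN zP) a0 b0.
  - move=> s sS; have [//|zs1] := point_singular zP sS.
    by case: z0; exists s.
have sep z w : z <> w -> exists2 g, spectrum_val z g = 1 & spectrum_val w g = 0.
  move=> zw; have zP := spectrum_valP z; have wP := spectrum_valP w.
  have [t tS zt] := nonzero z.
  have : exists2 s, singular s & spectrum_val z s <> spectrum_val w s.
    apply: contrapT => h; apply: zw; apply: val_inj; apply/funext.
    apply: (specker_ind (us_specker G)).
    - by rewrite [LHS](point0 zP) [RHS](point0 wP).
    - move=> a b ab bb; rewrite [LHS](pointD zP) [RHS](pointD wP).
      by rewrite (pointN zP) (pointN wP); congr (_ - _).
    - by move=> s sS; apply: contrapT => zws; apply: h; exists s.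
  case=> s sS; case: (point_singular zP sS); case: (point_singular wP sS).
  - by move=> -> ->.
  (* Here [s] is 0 at [z] and 1 at [w]: the difference keeps the value 1 of [t] at [z] and is 0 at
     [w], where [t] is at most 1. *)
  - move=> ws zs _; exists (t - lmeet s t).
      by rewrite (pointD zP) (pointN zP) (point_meet zP) zs zt.
    rewrite (pointD wP) (pointN wP) (point_meet wP) ws.
    by case: (point_singular wP tS) => ->.
  - by move=> ws zs _; exists s.
  - by move=> -> ->.
have [-> {x xP}|xy] := pselect (x = y).
  have [s _ ys] := nonzero y.
  exists (eval (s *~ f y)); first by exists (s *~ f y).
  suff E : eval (s *~ f y) y = f y by [].
  by rewrite [LHS](pointMz yP) ys intz.
have [s xs ys] := sep x y xy; have [t yt xt] := sep y x (nesym xy).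
exists (eval (s *~ f x + t *~ f y)); first by exists (s *~ f x + t *~ f y).
split.
  by rewrite [LHS](pointD xP) !(pointMz xP) xs xt mul0rz addr0 intz.
by rewrite [LHS](pointD yP) !(pointMz yP) ys yt mul0rz add0r intz.
Qed.

End Spectrum.

(** * Quasi-components and clopen sets in boolean spaces *)

Section BooleanSpaces.
Context (X : topologicalType).

Definition quasi_component (x : X) : set X :=
  [set y | forall U, clopen U -> U x -> U y].

(** If the quasi-component splits into closed parts [B] and [D], normality separates them by
    disjoint open [U] and [V], and some clopen [N] around [x] lies in their union. The trace of [N]
    on [U] or [V] that contains [x] is clopen, so it contains the whole quasi-component. *)
Lemma quasi_component_connected x : hausdorff_space X -> compact [set: X] ->
  connected (quasi_component x).
Proof.
move=> hX cX B [b Bb] [O oO BO] [C cC BC].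
have Q_closed : closed (quasi_component x).
  move=> y yQ U clU Ux; apply: (proj2 clU) => N /yQ[z [zQ Nz]].
  by exists z; split=> //; exact: zQ.
pose D := quasi_component x `\` B.
have B_closed : closed B by rewrite BC; exact: closedI.
have D_closed : closed D.
  rewrite /D BO setDIr setDv set0U setDE; apply: closedI => //.
  exact: open_closedC.
have [W BW WD] : exists2 W, set_nbhs B W & closure W `<=` ~` D.
  have /(compact_normal hX cX B_closed)[W BW WD] : set_nbhs B (~` D).
    move=> y By; apply: open_nbhs_nbhs; split=> [|[_ /(_ By)] //].
    exact: closed_openC.
  by exists W.
pose U := W^°; pose V := ~` closure W.
have oU : open U by exact: open_interior.
have oV : open V by apply: closed_openC; exact: closed_closure.
have UV y : U y -> ~ V y.
  by move=> /interior_subset Wy; apply; exact: subset_closure.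
have BU : B `<=` U.
  by move=> y /BW.
have DV : D `<=` V by move=> y Dy /WD.
(* A point outside [U] and [V] is outside the quasi-component, so a clopen set around [x] misses a
   neighbourhood of it; intersections merge these sets. *)
have [N [[oN cN] Nx] NUV] : exists2 N : set X, clopen N /\ N x &
    forall y, N y -> U y \/ V y.
  apply: (@compact_directed X _ [set N : set X | clopen N /\ N x]
    (fun N y => N y -> U y \/ V y) cX).
  - by exists setT; split=> //; exact: clopenT.
  - move=> M N [clM Mx] [clN Nx]; exists (M `&` N).
      by split; [exact: clopenI | split].
    by move=> y MN [My Ny]; case: MN; apply.
  - move=> y; have [UVy|UVy] := pselect (U y \/ V y).
      exists setT; first by split=> //; exact: clopenT.
      have : nbhs y (U `|` V).
        by apply: open_nbhs_nbhs; split=> //; exact: openU.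
      by apply: filterS.
    have /existsNP[N /not_implyP[clN /not_implyP[Nx Ny]]] :
        ~ quasi_component x y.
      move=> Qy; apply: UVy; have [By|By] := pselect (B y).
        by left; exact: BU.
      by right; apply: DV.
    exists N => //; have : nbhs y (~` N).
      by apply: open_nbhs_nbhs; split=> //; case: clN => _ /closed_openC.
    by apply: filterS => z.
have clNU : clopen (N `&` U).
  split; first exact: openI.
  have -> : N `&` U = N `\` V.
    apply/seteqP; split=> y [Ny]; first by move/UV.
    by case: (NUV y Ny) => // ? ?.
  by rewrite setDE; apply: closedI => //; exact: open_closedC.
have clNV : clopen (N `&` V).
  split; first exact: openI.
  have -> : N `&` V = N `\` U.
    apply/seteqP; split=> y [Ny]; first by move=> Vy; split=> // /UV.
    by case: (NUV y Ny) => // ? ?.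
  by rewrite setDE; apply: closedI => //; exact: open_closedC.
(* If [x] is in [B], no point is left for [D]; otherwise the point [b] of [B] would lie in [V]. *)
have [Bx|nBx] := pselect (B x).
  have QU y : quasi_component x y -> U y.
    by move=> /(_ _ clNU (conj Nx (BU x Bx)))[].
  rewrite eqEsubset; split=> y; first by rewrite BO => -[].
  move=> Qy; apply: contrapT => nBy.
  exact: UV (QU y Qy) (DV y (conj Qy nBy)).
have Vx : V x by apply: DV; split.
have Qb : quasi_component x b by move: Bb; rewrite BO => -[].
by have [_ Vb] := Qb _ clNV (conj Nx Vx); case: (UV b (BU b Bb)).
Qed.

(** Points that no clopen set separates share a quasi-component, which is connected and hence a
    singleton. *)
Lemma boolean_zero_dimensional : boolean_space X -> zero_dimensional X.
Proof.
move=> [tX cX hX] x y /eqP xy; apply: contrapT => nU.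
have Qy : quasi_component x y.
  by move=> U clU Ux; apply: contrapT => Uy; apply: nU; exists U.
apply/xy/esym; suff : [set x] y by [].
rewrite -(tX x I); exists (quasi_component x) => //.
by split=> //; exact: quasi_component_connected.
Qed.

Lemma clopen_indicator_continuous (U : set X) : clopen U ->
  continuous ((fun x => (`[< U x >] : nat)%:Z) : X -> discrete_topology int).
Proof.
move=> [oU cU]; apply: locally_constant_cts => x.
have [Ux|Ux] := pselect (U x).
  have : nbhs x U by exact: open_nbhs_nbhs.
  by apply: filterS => y Uy; rewrite !asboolT.
have : nbhs x (~` U) by apply: open_nbhs_nbhs; split=> //; exact: closed_openC.
by apply: filterS => y Uy; rewrite !asboolF.
Qed.

Definition clopen_indicator (U : set X) (clU : clopen U) : ctsZ X :=
  mkctsZ (clopen_indicator_continuous clU).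

End BooleanSpaces.

(** * Faithfulness and fullness of the functor *)

Lemma ctsZB (X : topologicalType) (f g : ctsZ X) x :
  (f - g : ctsZ X) x = f x - g x.
Proof. by []. Qed.

Lemma ctsZ_mulrz (X : topologicalType) (f : ctsZ X) n x :
  (f *~ n : ctsZ X) x = f x * n.
Proof.
have evD : {morph (fun g : ctsZ X => g x) : a b / a + b} by [].
by rewrite (additiveMz evD) -mulrzr intz.
Qed.

(** If [f w] and [g w] differ, the indicator of a clopen set containing only [f w] is sent at [w] to
    a nonzero quotient of multiplicities by one map and to 0 by the other. *)
Lemma S_functor_faithful (W V : Bms) (f g : hom W V) :
  fmap S_functor f = fmap S_functor g -> f = g.
Proof.
move=> fg; apply: bms_hom_eq => w; apply: contrapT => /eqP fgw.
have [U [clU Ufw Ugw]] := boolean_zero_dimensional (bms_boolean V) fgw.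
have := congr1 (fun h : unital_lhom (S_obj V) (S_obj W) =>
  (h (clopen_indicator clU) : ctsZ W) w) fg.
change ((`[< U (f w) >] : nat)%:Z * (bms_mult W w %/ bms_mult V (f w))%Z =
  (`[< U (g w) >] : nat)%:Z * (bms_mult W w %/ bms_mult V (g w))%Z -> False).
rewrite asboolT // asboolF // mul1r mul0r => q0.
have := divzK (bms_dvd f w); rewrite q0 mul0r => /esym/eqP.
by rewrite gt_eqF // bms_mult_gt0.
Qed.

Section Full.
Context (W V : boolean_multispace) (psi : unital_lhom (S_obj V) (S_obj W)).
Implicit Types f g : ctsZ V.

Local Notation at_ f w := ((psi f : ctsZ W) w).

(** Otherwise each [v] is a zero of some function whose image is nonzero at [w]. Absolute values
    make these functions nonnegative, meets unite their zero sets, and by compactness the zero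
    function would have a positive image at [w]. *)
Lemma lhom_vanishes_at w : exists v, forall f : ctsZ V, f v = 0 -> at_ f w = 0.
Proof.
have [psiD psiI psiU psi1] := lhomP psi.
have psi0 : psi 0 = 0 := additive0 psiD.
have psi_meet f g : at_ (lmeet f g) w = Num.min (at_ f w) (at_ g w).
  by rewrite [psi _]psiI ctsZ_lmeetE.
have psi_join f g : at_ (ljoin f g) w = Num.max (at_ f w) (at_ g w).
  by rewrite [psi _]psiU ctsZ_ljoinE.
apply: contrapT => /forallNP novan.
have [f [f0 fw] fv] : exists2 f : ctsZ V, (forall v, 0 <= f v) /\ 0 < at_ f w &
    forall v, f v = 0.
  apply: (@compact_directed V _
    [set f : ctsZ V | (forall v, 0 <= f v) /\ 0 < at_ f w]
    (fun f v => f v = 0) (@bms_compact V)).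
  - exists (bms_mult V); split=> [v|]; first exact/ltW/bms_mult_gt0.
    by rewrite [psi _]psi1; exact: bms_mult_gt0.
  - move=> f g [f0 fw] [g0 gw]; exists (lmeet f g).
      split=> [v|]; first by rewrite ctsZ_lmeetE le_min f0 g0.
      by rewrite psi_meet lt_min fw gw.
    by move=> v; rewrite ctsZ_lmeetE; have := f0 v; have := g0 v; lia.
  - move=> v; have /existsNP[f /not_implyP[fv fw]] := novan v.
    pose a : ctsZ V := ljoin f (- f).
    have aE x : a x = Num.max (f x) (- f x) by rewrite /a ctsZ_ljoinE.
    exists a.
      split=> [x|]; first by rewrite aE; lia.
      rewrite psi_join [psi (- f)](additiveN psiD).
      by change (0 < Num.max (at_ f w) (- at_ f w)); lia.
    by apply: filterS (ctsZ_near f v) => x fx; rewrite aE fx fv.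
have f_eq0 : f = 0 by apply: ctsZP => v; rewrite fv.
by move: fw; rewrite f_eq0 psi0.
Qed.

(** The combination [h] of [f] and [bms_mult V] vanishes at [v], and [psi] sends [bms_mult V] to
    [bms_mult W]. *)
Lemma lhom_at w v : (forall f, f v = 0 -> at_ f w = 0) ->
  forall f, bms_mult V v * at_ f w = f v * bms_mult W w.
Proof.
have [psiD _ _ psi1] := lhomP psi.
move=> van f; pose h : ctsZ V := f *~ bms_mult V v - bms_mult V *~ f v.
have hv : h v = 0.
  by rewrite [LHS]ctsZB !ctsZ_mulrz; lia.
move/van: hv; rewrite [psi _]psiD [psi (- _)](additiveN psiD).
rewrite [psi (f *~ _)](additiveMz psiD) [psi (_ *~ f v)](additiveMz psiD).
rewrite [psi (bms_mult V)]psi1 => hw.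
have : ((psi f : ctsZ W) *~ bms_mult V v - bms_mult W *~ f v : ctsZ W) w = 0.
  by [].
by rewrite ctsZB !ctsZ_mulrz; lia.
Qed.

Lemma S_functor_full : exists gamma : bms_hom W V, S_mor gamma = psi.
Proof.
have [gamma gammaP] := choice lhom_vanishes_at.
have gammaE w := lhom_at (gammaP w).
have mult1 w : bms_mult V (gamma w) * at_ (ctsZ_cst V 1) w = bms_mult W w.
  by rewrite gammaE mul1r.
have gamma_dvd w : (bms_mult V (gamma w) %| bms_mult W w)%Z.
  by rewrite -mult1 dvdz_mulr.
(* The image under [psi] of the indicator of a clopen [U] is locally constant, and by [gammaE] it is
   nonzero at [w'] exactly when [gamma w'] lies in [U]. *)
have gamma_cts : continuous gamma.
  move=> w N Nw; have zV := boolean_zero_dimensional (bms_boolean V).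
  have [tV cV hV] := bms_boolean V.
  have [U [Uw clU] UN] := zero_dimensional_cvg hV zV cV Nw.
  have indE w' := gammaE w' (clopen_indicator clU).
  apply: filterS (ctsZ_near (psi (clopen_indicator clU)) w) => w' psiw.
  apply: UN; apply: contrapT => nU.
  have := indE w'; rewrite psiw.
  have -> : clopen_indicator clU (gamma w') = 0.
    by change ((`[< U (gamma w') >] : nat)%:Z = 0); rewrite asboolF.
  rewrite mul0r => /eqP; rewrite mulf_eq0 gt_eqF ?bms_mult_gt0 //=.
  move=> /eqP psi0; have := indE w; rewrite psi0 mulr0.
  have -> : clopen_indicator clU (gamma w) = 1.
    by change ((`[< U (gamma w) >] : nat)%:Z = 1); rewrite asboolT.
  by rewrite mul1r => /esym/eqP; rewrite gt_eqF ?bms_mult_gt0.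
exists (BmsHom gamma_cts gamma_dvd); apply: unital_lhom_eq => f.
apply: ctsZP => w.
change (f (gamma w) * (bms_mult W w %/ bms_mult V (gamma w))%Z = at_ f w).
have V0 : bms_mult V (gamma w) != 0 by rewrite gt_eqF // bms_mult_gt0.
apply: (mulfI V0); rewrite gammaE mulrCA; congr (_ * _).
by rewrite mulrC divzK.
Qed.

End Full.

Theorem theorem4p2 :
  is_equivalence (S_functor : functor Bms (opposite uSlg)).
Proof.
apply: fully_faithful_essentially_surjective.
- by move=> W V psi; exact: (S_functor_full psi).
- exact: S_functor_faithful.
(* In the opposite category an arrow from the function group to [G] is a homomorphism out of [G], so
   evaluation has the right direction; its inverse preserves the structure because [eval] is
   injective. *)
move=> G; exists (spectrum_bms G), (UnitalLHom (eval_lhom G)).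
have [evD evI evU ev1] := eval_lhom G.
have [inv invK] := choice (@eval_surj G).
have evK g : inv (eval g) = g by apply: eval_inj; rewrite invK.
have inv_lhom : @is_unital_lhom (S_obj (spectrum_bms G)) G inv.
  split=> [f h|f h|f h|]; apply: eval_inj; rewrite invK.
  - by rewrite evD !invK.
  - by rewrite evI !invK.
  - by rewrite evU !invK.
  - by [].
by exists (UnitalLHom inv_lhom); split; apply: unital_lhom_eq.
Qed.
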